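(* Let $S=(S,\le)$ be a partially ordered Polish space in which a subset is compact if and only if it is closed and order bounded. Equip $\mathcal P(S)$ with the stochastic dominance order $\preceq_{\mathrm{sd}}$ and the Bhattacharya metric $\beta$. Let $\mathbb T$ be either $\mathbb R_+$ or $\mathbb Z_+$, and let $(T_t)_{t\in\mathbb T}$ be an order-preserving semigroup on $\mathcal P(S)$. The following statements are equivalent: (i) $(T_t)$ is globally stable on $\mathcal P(S)$. (ii) $(T_t)$ is asymptotically contractive and has an order-bounded trajectory in $\mathcal P(S)$. (iii) $(T_t)$ is asymptotically contractive and has a tight trajectory in $\mathcal P(S)$.
   Context: A partially ordered Polish space is a separable, completely metrizable topological space $S$ with a closed partial order $\le$ (that is, $x_i\le y_i$, $x_i\to x$, $y_i\to y$ imply $x\le y$). A subset of a partially ordered set is order bounded if it is contained in an order interval $[a,b]=\{x:a\le x\le b\}$ with $a \le b$. $\mathcal P(S)$ is the set of Borel probability measures on $S$; $ibS$ is the set of bounded Borel measurable $h:S\to\mathbb R$ that are increasing ($x\le y$ implies $h(x)\le h(y)$); $\phi(h)=\int h\,d\phi$. Stochastic dominance: $\phi\preceq_{\mathrm{sd}}\psi$ iff $\phi(h)\le\psi(h)$ for all $h\in ibS$; this is a partial order on $\mathcal P(S)$. Bhattacharya metric: $\beta(\phi,\psi)=\sup\{|\phi(h)-\psi(h)|: h\in ibS,\ |h|\le1\}$. A set $\Phi\subset\mathcal P(S)$ is tight if for all $\epsilon>0$ there is a compact $K\subset S$ with $\phi(K^c)\le\epsilon$ for all $\phi\in\Phi$.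 A semigroup on $\mathcal P(S)$ is a family of maps $T_t:\mathcal P(S)\to\mathcal P(S)$, $t\in\mathbb T$, with $T_0$ the identity and $T_{s+t}=T_s\circ T_t$ (no linearity or continuity is assumed). It is order-preserving if $\phi\preceq_{\mathrm{sd}}\psi$ implies $T_t\phi\preceq_{\mathrm{sd}}T_t\psi$ for every $t$. It has an order-bounded trajectory if there are $\phi,\ell,u\in\mathcal P(S)$ with $\ell\preceq_{\mathrm{sd}}T_t\phi\preceq_{\mathrm{sd}}u$ for all $t\in\mathbb T$; it has a tight trajectory if there is $\phi\in\mathcal P(S)$ with $\{T_t\phi:t\in\mathbb T\}$ tight. It is asymptotically contractive if $\beta(T_t\phi,T_t\psi)\to0$ as $t\to\infty$ for all $\phi,\psi\in\mathcal P(S)$. It is globally stable if there is a unique $\phi^*\in\mathcal P(S)$ with $T_t\phi^*=\phi^*$ for all $t\in\mathbb T$, and $\beta(T_t\phi,\phi^* )\to0$ as $t\to\infty$ for all $\phi\in\mathcal P(S)$. *)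

(* Defs.v *)
From HB Require Import structures.
From mathcomp Require Import all_boot all_order all_algebra.
From mathcomp Require Import all_classical all_reals all_analysis.

Set Implicit Arguments.
Unset Strict Implicit.
Unset Printing Implicit Defensive.

Import Order.TTheory GRing.Theory Num.Theory.
Import numFieldNormedType.Exports.

Local Open Scope classical_set_scope.
Local Open Scope ring_scope.

Section topology.

Definition separable (S : topologicalType) : Prop :=
  exists2 D : set S, countable D & dense D.

Definition completely_metrizable (R : realType) (S : topologicalType) : Prop :=
  exists d : S -> S -> R,
    [/\ [/\ forall x y, 0 <= d x y,
            forall x y, d x y = 0 <-> x = y,
            forall x y, d x y = d y x &
            forall x y z, d x z <= d x y + d y z],
        forall x, nbhs x =
          filter_from [set e : R | 0 < e] (fun e => [set y | d x y < e]) &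
        forall u : nat -> S,
          (forall e : R, 0 < e -> exists N : nat, forall m n : nat,
             (N <= m)%N -> (N <= n)%N -> d (u m) (u n) < e) ->
          exists l : S, u @ \oo --> l].

Definition Polish (R : realType) (S : topologicalType) : Prop :=
  separable S /\ completely_metrizable R S.

End topology.

(* Measurable types are pointed in the library, hence the pointed carrier. No
   generality is lost: if every compact set is order bounded, then in
   particular set0 is, so the space is nonempty. *)
Notation poPTopologicalType := POrderedPointedTopological.type.

Section order.
Context (d : Order.disp_t) (S : poPTopologicalType d).

Definition closed_order : Prop :=
  forall (x y : nat -> S) (a b : S),
    (forall i, (x i <= y i)%O) -> x @ \oo --> a -> y @ \oo --> b ->
    (a <= b)%O.

Definition order_bounded (A : set S) : Prop :=
  exists a b : S, (a <= b)%O /\ A `<=` [set` `[a, b]%O].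

End order.

Notation borel S := (g_sigma_algebraType (@open S)).

Section measures.
Context (R : realType) (d : Order.disp_t) (S : poPTopologicalType d).

(* A library measure is a function on all sets, constrained on measurable ones
   only, so two elements of probability (borel S) R may be the same Borel
   measure without being equal. Fixing the value 0 outside the Borel sets
   selects exactly one representative of each Borel probability measure (prob_ext
   and prob_of below), so that = on prob is equality of Borel measures. *)
Record prob := Prob {
  prob_measure :> probability (borel S) R;
  prob_nonmeasurable :
    forall A : set (borel S), ~ measurable A -> prob_measure A = 0%E }.

Lemma prob_ext (p q : prob) :
  (forall A : set (borel S), measurable A -> p A = q A) -> p = q.
Proof.
case: p q => [p p0] [q q0] /= pq.
have {}pq : (p : set (borel S) -> \bar R) = q.
  apply/funext => A; have [mA|mA] := pselect (measurable A); first exact: pq.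
  by rewrite p0// q0.
suff epq : p = q by subst q; congr Prob; exact: Prop_irrelevance.
case: p q pq {p0 q0} => [p cp] [q cq] /= pq; subst q.
congr Probability.Pack.
case: cp cq => [[a b] [c] [e] [f] [g] [h] [k]] [[a' b'] [c'] [e'] [f'] [g'] [h'] [k']].
have ? := Prop_irrelevance a a'; have ? := Prop_irrelevance b b'; subst.
have ? := Prop_irrelevance c c'; have ? := Prop_irrelevance e e'; subst.
have ? := Prop_irrelevance f f'; have ? := Prop_irrelevance g g'; subst.
by have ? := Prop_irrelevance h h'; have ? := Prop_irrelevance k k'; subst.
Qed.

Section representative.
Variable mu : probability (borel S) R.

Let m (A : set (borel S)) : \bar R := if `[<measurable A>] then mu A else 0%E.

Let mE A : measurable A -> m A = mu A.
Proof. by move=> mA; rewrite /m asboolT. Qed.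

Let m0 : m set0 = 0%E.
Proof. by rewrite mE ?measure0. Qed.

Let m_ge0 A : (0 <= m A)%E.
Proof. by rewrite /m; case: asboolP. Qed.

Let m_sigma_additive : semi_sigma_additive m.
Proof.
move=> F mF tF mUF; rewrite mE//.
under eq_cvg => n do under eq_bigr => i _ do rewrite mE//.
exact: measure_semi_sigma_additive.
Qed.

HB.instance Definition _ := isMeasure.Build _ _ _ m m0 m_ge0 m_sigma_additive.

Let m_setT : m [set: borel S] = 1%E.
Proof. by rewrite mE ?probability_setT. Qed.

HB.instance Definition _ := Measure_isProbability.Build _ _ _ m m_setT.

Definition prob_of : prob.
Proof.
by apply: (@Prob m) => A mA; rewrite /= /m asboolF.
Defined.

Lemma prob_ofE (A : set (borel S)) : measurable A -> prob_of A = mu A.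
Proof. exact: mE. Qed.

End representative.

Implicit Types (phi psi : prob) (h : S -> R).

Definition ib : set (S -> R) :=
  [set h | [/\ exists M : R, forall x, `|h x| <= M,
               measurable_fun [set: borel S] (h : borel S -> R) &
               forall x y : S, (x <= y)%O -> h x <= h y]].

Definition expect phi h : R := (\int[phi]_(x in [set: borel S]) h x)%R.

Definition sd phi psi : Prop :=
  forall h, ib h -> expect phi h <= expect psi h.

(* A supremum in R: the set is nonempty (h = 0) and bounded above by 2. *)
Definition bhattacharya phi psi : R :=
  sup [set `|expect phi h - expect psi h| |
       h in [set h | ib h /\ forall x, `|h x| <= 1]].

Definition tight (Phi : set prob) : Prop :=
  forall e : R, 0 < e -> exists2 K : set S, compact K &
    forall phi, Phi phi -> (phi (~` K) <= e%:E)%E.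

End measures.
Arguments prob : clear implicits.
Arguments prob R {d} S.

Definition time_continuous (R : realType) : set R := [set t | 0 <= t].
Definition time_discrete (R : realType) : set R :=
  range (fun n : nat => n%:R : R).
Arguments time_continuous : clear implicits.
Arguments time_discrete : clear implicits.

(* A family of maps indexed by TT is given by a function on R of which only
   the values T t with t in TT are ever used. *)
Section semigroups.
Context (R : realType) (d : Order.disp_t) (S : poPTopologicalType d).
Variables (TT : set R) (T : R -> prob R S -> prob R S).

Definition semigroup : Prop :=
  (forall phi, T 0 phi = phi) /\
  (forall s t, TT s -> TT t -> forall phi, T (s + t) phi = T s (T t phi)).

Definition order_preserving : Prop :=
  forall t, TT t -> forall phi psi, sd phi psi -> sd (T t phi) (T t psi).

Definition order_bounded_trajectory : Prop :=
  exists phi l u : prob R S,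
    forall t, TT t -> sd l (T t phi) /\ sd (T t phi) u.

Definition tight_trajectory : Prop :=
  exists phi : prob R S, tight [set T t phi | t in TT].

Definition asymptotically_contractive : Prop :=
  forall phi psi : prob R S,
    bhattacharya (T t phi) (T t psi) @[t --> within TT (pinfty_nbhs R)]
      --> (0 : R).

Definition stationary (phi : prob R S) : Prop :=
  forall t, TT t -> T t phi = phi.

Definition globally_stable : Prop :=
  exists phis : prob R S,
    [/\ stationary phis,
        forall psi, stationary psi -> psi = phis &
        forall phi, bhattacharya (T t phi) phis
          @[t --> within TT (pinfty_nbhs R)] --> (0 : R)].

End semigroups.

(* Main.v *)
From HB Require Import structures.
Require Import Defs.
From mathcomp Require Import all_boot all_order all_algebra.
From mathcomp Require Import all_classical all_reals all_analysis.
From mathcomp Require Import measurable_realfun lra.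

Set Implicit Arguments.
Unset Strict Implicit.
Unset Printing Implicit Defensive.

Import Order.TTheory GRing.Theory Num.Theory.
Import numFieldNormedType.Exports.

Local Open Scope classical_set_scope.
Local Open Scope ring_scope.

(** The implications out of global stability are cheap. If every trajectory
    converges to phis, then any two of them merge, by the triangle inequality
    for the Bhattacharya metric beta; and the constant trajectory of phis is
    bounded above and below by phis itself.

    For the converse, tightness and order boundedness of a trajectory are the
    same thing. If l and u bound it, then an order interval that carries almost
    all the mass of l and of u carries almost all the mass of every
    distribution in between, and order intervals are compact
    (order_bounded_tight). Conversely, compact sets are order bounded, so a
    tight family has a common decay rate of its mass outside the lower sets of
    an increasing sequence of points; a discrete measure on that sequence with
    a heavier tail dominates the family, and dually from below
    (tight_order_bounded).

    Now let l and u bound the trajectory of phi. Applying T_s to the bounds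
    for T_(t-s) phi shows that T_t phi lies between T_s l and T_s u as soon as
    s <= t. A limit point phis of this tight trajectory (the ultrafilter form
    of Prokhorov's theorem, tight_ultrafilter_limit) inherits these bounds for
    every s (trajectory_limit). Hence phis and T_r phis both lie between T_s l
    and T_s u for all s >= r, so that
      beta (T_r phis, phis) <= beta (T_s l, T_s u),
    which tends to 0 by asymptotic contractivity. As beta separates points,
    phis is stationary, and contractivity alone then makes it unique and
    globally attracting.

    Two facts about dominance carry the argument. It can be tested on closed
    up-sets (sd_upset, saturated_closed_le), which is why it passes to weak
    limits: the measure of a closed set is upper semicontinuous. And it is
    antisymmetric (sd_antisymmetric), which is why beta separates points. Both
    rest on inner regularity of Borel probabilities on a Polish space
    (Borel_compact_inner) and on the fact that the up-set generated by a
    compact set is closed (closed_saturation). *)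

(** * Compactness and ultrafilters *)

(** The sets satisfying I form an ideal; if K were not among them, the
    complements relative to K would generate a proper filter, and a cluster
    point of it would contradict the local hypothesis. This form of the
    Heine-Borel argument spares the bookkeeping of finite subcovers. *)
Lemma compact_induction (T : topologicalType) (K : set T) (I : set (set T)) :
  compact K -> I set0 -> (forall A B, A `<=` B -> I B -> I A) ->
  (forall A B, I A -> I B -> I (A `|` B)) ->
  (forall x, K x -> exists2 U, nbhs x U & I (K `&` U)) -> I K.
Proof.
move=> cK I0 IS IU Iloc; apply: contrapT => nIK.
pose F : set_system T := [set B | I (K `\` B)].
have PF : ProperFilter F.
  split; first by rewrite /F /= setD0.
  split; first by rewrite /F /= setDT.
  - by move=> A B FA FB; rewrite /F /= setDIr; exact: IU.
  - by move=> A B AB FA; apply: IS FA; exact: setDS.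
have [|x [Kx clx]] := cK F PF; first by rewrite /F /= setDv.
have [U Ux IKU] := Iloc x Kx.
have FU : F (~` U) by rewrite /F /= setDE setCK.
by have [y []] := clx _ _ FU Ux.
Qed.

Lemma ultra_bigcup (T : Type) (G : set_system T) (F : nat -> set T) n :
  UltraFilter G -> G (\bigcup_(i < n) F i) -> exists i, G (F i).
Proof.
move=> GU; elim: n => [|n IH].
  rewrite bigcup0; last by move=> i; rewrite /= ltn0.
  by move=> /filter_ex[].
rewrite (_ : \bigcup_(i < n.+1) F i = \bigcup_(i < n) F i `|` F n); last first.
  by rewrite !bigcup_mkord big_ord_recr.
move=> GFn; have [/IH//|Gn] := in_ultra_setVsetC (\bigcup_(i < n) F i) GU.
exists n; apply: filterS (filterI GFn Gn) => x [[]//].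
Qed.

Lemma ultra_cvg_segment (R : realType) (I : Type) (G : set_system I)
    (f : I -> R) (a b : R) : UltraFilter G ->
  (forall i, a <= f i <= b) -> exists l : R, f i @[i --> G] --> l.
Proof.
move=> GU fab; have [|l [_ fl]] := @segment_compact R a b (f @ G).
  by apply: nearW => i /=; rewrite in_itv/=; exact: fab.
exists l => U Ul; have [//|GnU] := in_ultra_setVsetC (f @^-1` U) GU.
by have [x []] := fl (~` U) U GnU Ul.
Qed.

(** * Topology of Polish spaces *)

Section metric.
Context (R : realType) (S : ptopologicalType) (dist : S -> S -> R).
Hypothesis dist_ge0 : forall x y, 0 <= dist x y.
Hypothesis dist_eq0 : forall x y, dist x y = 0 <-> x = y.
Hypothesis distC : forall x y, dist x y = dist y x.
Hypothesis dist_triangle : forall x y z, dist x z <= dist x y + dist y z.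
Hypothesis nbhs_dist : forall x, nbhs x =
  filter_from [set e : R | 0 < e] (fun e => [set y | dist x y < e]).

Let nbhs_ball x e : 0 < e -> nbhs x [set y | dist x y < e].
Proof. by move=> e0; rewrite nbhs_dist; exists e. Qed.

Let closed_ball_closed x e : closed [set y | dist x y <= e].
Proof.
move=> y cly /=; rewrite leNgt; apply/negP => ey.
have [|z [/= xz yz]] := cly [set z | dist y z < dist x y - e].
  by apply: nbhs_ball; rewrite subr_gt0.
have := dist_triangle x z y; rewrite (distC z y); lra.
Qed.

Lemma metric_regular (x : S) (U : set S) : nbhs x U ->
  exists C, [/\ closed C, nbhs x C & C `<=` U].
Proof.
rewrite {1}nbhs_dist => -[e /= e0 eU].
exists [set y | dist x y <= e / 2]; split; first exact: closed_ball_closed.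
  apply: (filterS _ (nbhs_ball x (divr_gt0 e0 (ltr0n R 2)))) => y /=.
  exact: ltW.
move=> y /= xy; apply: eU => /=; lra.
Qed.

Lemma metric_first_countable (x : S) : exists B : nat -> set S,
  (forall n, nbhs x (B n)) /\
  forall u : nat -> S, (forall n, B n (u n)) -> u @ \oo --> x.
Proof.
exists (fun n => [set y | dist x y < n.+1%:R^-1]); split.
  by move=> n; apply: nbhs_ball; rewrite invr_gt0.
move=> u Bu U; rewrite nbhs_dist => -[e /= e0 eU].
rewrite nbhs_simpl /=; near=> n; apply: eU; have /= /lt_trans := Bu n; apply.
near: n; exact: near_infty_natSinv_lt (PosNum e0).
Unshelve. all: by end_near. Qed.

Lemma metric_hausdorff : hausdorff_space S.
Proof.
move=> x y xy; apply/dist_eq0/eqP; rewrite eq_le dist_ge0 andbT leNgt.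
apply/negP => dxy; pose e := dist x y / 2.
have e0 : 0 < e by rewrite /e; lra.
have [z [/= xz yz]] := xy _ _ (nbhs_ball x e0) (nbhs_ball y e0).
by have := dist_triangle x z y; rewrite (distC z y) /e in xz yz *; lra.
Qed.

Lemma metric_open_Fsigma (O : set S) : open O ->
  exists F : nat -> set S, [/\ forall n, closed (F n),
    nondecreasing_seq F & \bigcup_n F n = O].
Proof.
move=> oO; pose F n := \bigcap_(y in ~` O) [set x | n.+1%:R^-1 <= dist x y].
exists F; split.
- move=> n; apply: closed_bigI => y _ x clx /=; rewrite leNgt; apply/negP => xy.
  have [|z [/= yz xz]] := clx [set z | dist x z < n.+1%:R^-1 - dist x y].
    by apply: nbhs_ball; rewrite subr_gt0.
  move: (n.+1%:R^-1) yz xz {xy} => r yz xz.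
  by have := dist_triangle z x y; rewrite (distC z x); lra.
- move=> m n mn; apply/subsetPset => x Fx y Oy; apply: le_trans (Fx y Oy).
  by rewrite /= lef_pV2 ?posrE// ler_nat ltnS.
- apply/seteqP; split => [x [n _ Fx]|x Ox].
    apply: contrapT => Ox; have := Fx x Ox.
    by rewrite /= (dist_eq0 x x).2// leNgt invr_gt0 ltr0n.
  have : nbhs x O by exact: open_nbhs_nbhs.
  rewrite nbhs_dist => -[e /= e0 eO].
  have [n _ ne] := near_infty_natSinv_lt (PosNum e0).
  exists n => // y Oy /=; rewrite leNgt; apply/negP => xy.
  by apply: Oy; apply: eO => /=; apply: lt_trans xy (ne n _) => /=.
Qed.

(** Balls of radius 1/(k+1) around a countable dense set cover S for each k.
    Keeping finitely many of them for each k leaves a closed totally bounded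
    set, which is compact by completeness. Phrased with an abstract family of
    closed sets, this is all that Ulam's theorem needs to know about the
    metric. *)
Lemma metric_compact_grid : separable S ->
  (forall u : nat -> S,
    (forall e : R, 0 < e -> exists N : nat, forall m n : nat,
       (N <= m)%N -> (N <= n)%N -> dist (u m) (u n) < e) ->
    exists l : S, u @ \oo --> l) ->
  exists C : nat -> nat -> set S, [/\ forall k n, closed (C k n),
    forall k, \bigcup_n C k n = setT &
    forall N : nat -> nat, compact (\bigcap_k \bigcup_(n < N k) C k n)].
Proof.
move=> [D cD dD] complete.
have [q Dq] : exists q : nat -> S, D `<=` range q.
  have D0 : D !=set0.
    have [| |y [_ Dy]] := dD setT; [by exists point|exact: openT|by exists y].
  have /pcard_surjP[g gD] := cD.
  by exists g => y /gD[n _ <-]; exists n.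
exists (fun k n => [set y | dist (q n) y <= k.+1%:R^-1]); split.
- by move=> k n; exact: closed_ball_closed.
- move=> k; apply/seteqP; split => // x _.
  have k0 : 0 < k.+1%:R^-1 :> R by rewrite invr_gt0.
  have := nbhs_ball x k0; rewrite nbhsE => -[V [oV Vx] Vball].
  have [| |y [Vy Dy]] := dD V; [by exists x|exact: oV|].
  have [n _ qn] := Dq _ Dy; exists n => //=.
  by rewrite qn distC; apply: ltW; exact: Vball.
- move=> N; set K := bigcap _ _; rewrite compact_ultra => G GU GK.
  have cK : closed K.
    apply: closed_bigI => k _; rewrite bigcup_mkord.
    by apply: closed_bigsetU => n _; exact: closed_ball_closed.
  have /choice[f Gf] : forall k, exists n,
      G [set y | dist (q n) y <= k.+1%:R^-1].
    move=> k; apply: (@ultra_bigcup _ G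
      (fun n => [set y | dist (q n) y <= k.+1%:R^-1]) (N k)).
    by apply: filterS GK => x; exact.
  have dqf k l : dist (q (f k)) (q (f l)) <= k.+1%:R^-1 + l.+1%:R^-1.
    have [y [/=]] := filter_ex (filterI (Gf k) (Gf l)).
    move: (k.+1%:R^-1) (l.+1%:R^-1) => r s ky ly.
    have := dist_triangle (q (f k)) y (q (f l)); rewrite (distC y); lra.
  have [e e0|l ql] := complete (q \o f).
    have [n _ ne] := near_infty_natSinv_lt (PosNum (divr_gt0 e0 (ltr0n R 2))).
    exists n => i j ni nj /=; apply: le_lt_trans (dqf i j) _.
    move: (ne _ ni) (ne _ nj) => /=.
    by move: (i.+1%:R^-1) (j.+1%:R^-1) => r s; lra.
  (* A member of G that is a small ball with centre close to l lies inside the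
     given neighbourhood of l. *)
  have Gl : G --> l.
    move=> U; rewrite nbhs_dist => -[e /= e0 eU].
    have e2 := divr_gt0 e0 (ltr0n R 2).
    have [n _ ne] := near_infty_natSinv_lt (PosNum e2).
    have [m _ me] := ql _ (nbhs_ball l e2).
    have /= nk := ne _ (leq_maxl n m); have /= mk := me _ (leq_maxr n m).
    apply: filterS (Gf (maxn n m)) => y /= qy; apply: eU => /=.
    move: ((maxn n m).+1%:R^-1) nk qy => r nk qy.
    by have := dist_triangle l (q (f (maxn n m))) y; lra.
  exists l; split => //; apply: cK => U /Gl GU'.
  by have [y yy] := filter_ex (filterI GK GU'); exists y.
Qed.

End metric.

(** The same facts with the metric hidden: below, only the topology matters. *)
Section Polish_topology.
Context (R : realType) (S : ptopologicalType) (hS : Polish R S).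

Lemma Polish_regular (x : S) (U : set S) : nbhs x U ->
  exists C, [/\ closed C, nbhs x C & C `<=` U].
Proof. by have [_ [dist [[*]]]] := hS; exact: (@metric_regular R S dist). Qed.

Lemma Polish_hausdorff : hausdorff_space S.
Proof. by have [_ [dist [[*]]]] := hS; exact: (@metric_hausdorff R S dist). Qed.

Lemma Polish_first_countable (x : S) : exists B : nat -> set S,
  (forall n, nbhs x (B n)) /\
  forall u : nat -> S, (forall n, B n (u n)) -> u @ \oo --> x.
Proof.
by have [_ [dist [[*]]]] := hS; exact: (@metric_first_countable R S dist).
Qed.

Lemma Polish_open_Fsigma (O : set S) : open O ->
  exists F : nat -> set S, [/\ forall n, closed (F n),
    nondecreasing_seq F & \bigcup_n F n = O].
Proof.
by have [_ [dist [[*]]]] := hS; exact: (@metric_open_Fsigma R S dist).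
Qed.

Lemma Polish_compact_grid : exists C : nat -> nat -> set S,
  [/\ forall k n, closed (C k n), forall k, \bigcup_n C k n = setT &
  forall N : nat -> nat, compact (\bigcap_k \bigcup_(n < N k) C k n)].
Proof.
by have [sS [dist [[*]]]] := hS; exact: (@metric_compact_grid R S dist).
Qed.

End Polish_topology.

(** * Regularity of Borel probabilities *)

Lemma open_borel (S : ptopologicalType) (O : set S) :
  open O -> measurable (O : set (borel S)).
Proof. exact: sub_sigma_algebra. Qed.

Lemma closed_borel (S : ptopologicalType) (C : set S) :
  closed C -> measurable (C : set (borel S)).
Proof.
move=> cC; rewrite -(setCK (C : set (borel S))).
by apply: measurableC; apply: open_borel; exact: closed_openC.
Qed.

Lemma measure_bigcap_le d (T : measurableType d) (R : realType)
    (mu : probability T R) (G : nat -> set T) (e : R) :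
  (forall n, measurable (G n)) -> nonincreasing_seq G ->
  (mu (\bigcap_n G n) < e%:E)%E -> exists n, (mu (G n) <= e%:E)%E.
Proof.
move=> mG niG Ge.
have := @nonincreasing_cvg_mu _ _ _ mu G _ mG _ niG.
move=> /(_ _ _ [set x | x < e%:E]%E)[| | |n _ ne].
- by rewrite (le_lt_trans (probability_le1 _ _)) ?ltry.
- exact: bigcap_measurable.
- by apply: open_nbhs_nbhs; split => //; exact: open_ereal_lt_ereal.
- by exists n; apply: ltW; exact: ne n (leqnn n).
Qed.

Section Polish_measures.
Context (R : realType) (S : ptopologicalType) (hS : Polish R S).
Variable mu : probability (borel S) R.

(** Ulam's theorem: at level k, finitely many of the closed sets of the grid
    carry all the mass but e / 2^(k+1). *)
Lemma Polish_tight (e : R) : 0 < e ->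
  exists2 K : set S, compact K & (mu (~` K) <= e%:E)%E.
Proof.
move=> e0; have [C [cC CT cK]] := Polish_compact_grid hS.
have mC k n : measurable (C k n : set (borel S)) by exact: closed_borel.
have /choice[N eN] : forall k, exists n,
    (mu (~` \bigcup_(i < n) C k i) <= (e / (2 ^ k.+1)%:R)%:E)%E.
  move=> k.
  apply: (@measure_bigcap_le _ _ _ mu (fun n => ~` \bigcup_(i < n) C k i)).
  - by move=> n; apply: measurableC; exact: bigcup_measurable.
  - move=> m n mn; apply/subsetPset; apply: subsetC => x [i im Cx].
    by exists i => //; exact: leq_trans im mn.
  - rewrite (_ : \bigcap_n _ = set0) ?measure0 ?lte_fin ?divr_gt0//
      ?ltr0n ?expn_gt0//.
    apply/seteqP; split => // x Cx.
    have [n _ Cn] : (\bigcup_n C k n) x by rewrite CT.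
    by apply: (Cx n.+1 Logic.I); exists n => //=.
exists (\bigcap_k \bigcup_(n < N k) C k n) => //; rewrite setC_bigcap.
apply: le_trans (epsilon_trick0 xpredT (ltW e0)).
apply: le_trans.
  apply: (@generalized_Boole_inequality _ _ _ mu
    (fun k => ~` \bigcup_(n < N k) C k n)).
  - by move=> k; apply: measurableC; exact: bigcup_measurable.
  - apply: bigcup_measurable => k _.
    by apply: measurableC; exact: bigcup_measurable.
by apply: lee_nneseries => // k _; exact: eN.
Qed.

(** The sets that can be squeezed in this way form a sigma-algebra, and it
    contains the open sets because these are increasing countable unions of
    closed ones. *)
Lemma Borel_closed_open_regular (A : set (borel S)) (e : R) :
  measurable A -> 0 < e -> exists (C O : set S),
  [/\ closed C, open O, C `<=` A, A `<=` O & (mu (O `\` C) <= e%:E)%E].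
Proof.
pose Reg := [set A : set S | forall e : R, 0 < e -> exists (C O : set S),
  [/\ closed C, open O, C `<=` A, A `<=` O & (mu (O `\` C) <= e%:E)%E]].
suff : @measurable _ (borel S) `<=` Reg by move=> + mA; apply.
apply: smallest_sub; first split.
- move=> {}e e0; exists set0, set0.
  split; [exact: closed0|exact: open0|by []|by []|].
  by rewrite setD0 measure0 lee_fin ltW.
- move=> B RB {}e /RB[C [V [cC oV CB BV CVe]]].
  exists (~` V), (~` C); rewrite !setTD; split => //.
  + exact: open_closedC.
  + exact: closed_openC.
  + exact: subsetC.
  + exact: subsetC.
  + by rewrite setDE setCK setIC -setDE.
- move=> B RB {}e e0; have e2 : 0 < e / 2 by rewrite divr_gt0.
  have /choice[CO COP] : forall n, exists CO : set S * set S,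
      [/\ closed CO.1, open CO.2, CO.1 `<=` B n, B n `<=` CO.2 &
       (mu (CO.2 `\` CO.1) <= (e / 2 / (2 ^ n.+1)%:R)%:E)%E].
    move=> n; have [|C [V CVP]] := RB n (e / 2 / (2 ^ n.+1)%:R).
      by rewrite divr_gt0// ltr0n expn_gt0.
    by exists (C, V).
  (* The union of the inner closed sets need not be closed: a finite part of
     it is kept, at the price of the other half of e. *)
  pose O := \bigcup_n (CO n).2.
  have mC n : measurable ((CO n).1 : set (borel S)).
    by apply: closed_borel; have [] := COP n.
  have mO n : measurable ((CO n).2 : set (borel S)).
    by apply: open_borel; have [] := COP n.
  have mUO : measurable (O : set (borel S)) by exact: bigcup_measurable.
  have [| | |N Ne] := @measure_bigcap_le _ _ _ mu
      (fun N => O `\` \bigcup_(n < N) (CO n).1) e.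
  + by move=> n; apply: measurableD => //; exact: bigcup_measurable.
  + move=> m n mn; apply/subsetPset; apply: setDS => x [i im Cx].
    by exists i => //; exact: leq_trans im mn.
  + apply: (@le_lt_trans _ _ (e / 2)%:E); last first.
      by rewrite lte_fin ltr_pdivrMr// ltr_pMr// ltr1n.
    apply: le_trans (epsilon_trick0 xpredT (ltW e2)).
    apply: (@le_trans _ _
      (\sum_(n <oo) mu ((CO n).2 `\` (CO n).1))%E); last first.
      by apply: lee_nneseries => // n _; case: (COP n).
    apply: measure_sigma_subadditive.
    * by move=> n; exact: measurableD.
    * apply: bigcap_measurable => // n _.
      by apply: measurableD => //; exact: bigcup_measurable.
    * move=> x Ox; have [[n _ On] _] := Ox 0%N Logic.I.
      exists n => //; split => // Cn.
      by have [_] := Ox n.+1 Logic.I; apply; exists n => //=.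
  exists (\bigcup_(n < N) (CO n).1), O; split => //.
  + rewrite bigcup_mkord; apply: closed_bigsetU => n _.
    by have [] := COP n.
  + by apply: bigcup_open => n _; have [] := COP n.
  + by move=> x [n _ Cn]; exists n => //; have [_ _ + _ _] := COP n; exact.
  + by move=> x [n _ Bn]; exists n => //; have [_ _ _ + _] := COP n; exact.
- move=> O oO {}e e0; have [F [cF ndF FO]] := Polish_open_Fsigma hS oO.
  have [| | |n ne] := @measure_bigcap_le _ _ _ mu (fun n => O `\` F n) e.
  + move=> n; apply: measurableD; first exact: open_borel.
    exact: closed_borel.
  + move=> m n mn; apply/subsetPset; apply: setDS.
    by apply/subsetPset; exact: ndF.
  + rewrite (_ : \bigcap_n _ = set0) ?measure0 ?lte_fin//.
    apply/seteqP; split => // x OFx; have [Ox _] := OFx 0%N Logic.I.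
    by move: Ox; rewrite -FO => -[n _ Fx]; have [] := OFx n Logic.I.
  exists (F n), O; split => //.
  by rewrite -FO; exact: bigcup_sup.
Qed.

Lemma Borel_compact_inner (A : set (borel S)) (e : R) :
  measurable A -> 0 < e -> exists K : set S,
  [/\ compact K, K `<=` A & (mu A <= mu K + e%:E)%E].
Proof.
move=> mA e0; have e2 : 0 < e / 2 by rewrite divr_gt0.
have [C [V [cC oO CA AO COe]]] := Borel_closed_open_regular mA e2.
have [K cK Ke] := Polish_tight e2.
have mK : measurable (K : set (borel S)).
  apply: closed_borel; apply: compact_closed cK.
  exact: (Polish_hausdorff hS).
have mC := closed_borel cC; have mV := open_borel oO.
have mKC : measurable (K `&` C : set (borel S)) by exact: measurableI.
exists (K `&` C); split; first exact: compact_closedI.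
  by move=> x [_ /CA].
rewrite [e in leRHS]splitr EFinD addeA.
apply: (@le_trans _ _ (mu ((K `&` C) `|` (V `\` C) `|` ~` K))).
  rewrite le_measure ?inE//.
    apply: measurableU; last exact: measurableC.
    by apply: measurableU => //; exact: measurableD.
  move=> x Ax; have [Kx|] := pselect (K x); last by right.
  by left; have [Cx|nCx] := pselect (C x); [left|right; split => //; exact: AO].
apply: le_trans; first apply: measureU2.
  by apply: measurableU => //; exact: measurableD.
  exact: measurableC.
apply: leeD => //; apply: le_trans; first apply: measureU2 => //.
  exact: measurableD.
exact: leeD.
Qed.

End Polish_measures.

(** * Limits of tight families of probabilities *)

(** The classical extension of a content: a set function on compact sets that
    is monotone, subadditive, and additive on disjoint sets defines, through
    inner approximation of open sets and outer approximation of arbitrary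
    sets, an outer measure for which Borel sets are measurable. The tightness
    hypothesis makes the total mass 1. *)
Section compact_content.
Local Open Scope ereal_scope.
Context (R : realType) (S : ptopologicalType) (hS : Polish R S).
Variable lambda : set S -> R.
Hypothesis lambda_le1 : forall K, compact K -> (lambda K <= 1)%R.
Hypothesis lambda_le : forall K L, compact K -> compact L -> K `<=` L ->
  (lambda K <= lambda L)%R.
Hypothesis lambdaU_le : forall K L, compact K -> compact L ->
  (lambda (K `|` L) <= lambda K + lambda L)%R.
Hypothesis lambdaU : forall K L, compact K -> compact L -> K `&` L = set0 ->
  (lambda (K `|` L) = lambda K + lambda L)%R.
Hypothesis lambda_tight : forall e : R, (0 < e)%R ->
  exists2 K, compact K & (1 - e <= lambda K)%R.

Let inner (V : set S) : \bar R :=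
  ereal_sup [set (lambda K)%:E | K in [set K | compact K /\ K `<=` V]].
Let outer (A : set S) : \bar R :=
  ereal_inf [set inner V | V in [set V | open V /\ A `<=` V]].

Let lambda0 : lambda set0 = 0%R.
Proof.
by have := lambdaU (@compact0 S) (@compact0 S) (setI0 _); rewrite setU0; lra.
Qed.

Let lambda_inner K V : compact K -> K `<=` V -> (lambda K)%:E <= inner V.
Proof. by move=> cK KV; apply: ereal_sup_ubound; exists K. Qed.

Let inner_ge0 V : 0 <= inner V.
Proof.
apply: (@le_trans _ _ (lambda set0)%:E); first by rewrite lambda0.
by apply: lambda_inner => //; exact: compact0.
Qed.

Let inner_le1 V : inner V <= 1.
Proof.
by apply: ge_ereal_sup => _ [K [cK _] <-]; rewrite lee_fin lambda_le1.
Qed.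

Let inner_fin V : inner V \is a fin_num.
Proof. by rewrite ge0_fin_numE// (le_lt_trans (inner_le1 V))// ltry. Qed.

Let inner_adherent V (e : R) : (0 < e)%R ->
  exists K, [/\ compact K, K `<=` V & inner V <= (lambda K)%:E + e%:E].
Proof.
move=> e0; have [_ [K [cK KV] <-] Ke] := ub_ereal_sup_adherent e0 (inner_fin V).
by exists K; split => //; rewrite -leeBlDr// ltW.
Qed.

Let inner_le V W : V `<=` W -> inner V <= inner W.
Proof.
move=> VW; apply: ereal_sup_le => _ [K [cK KV] <-].
by exists K => //; split => //; exact: subset_trans VW.
Qed.

Let outer_inner V : open V -> outer V = inner V.
Proof.
move=> oV; apply/eqP; rewrite eq_le; apply/andP; split.
  by apply: ereal_inf_lbound; exists V => //; split.
by apply: le_ereal_inf_tmp => _ [W [_ VW] <-]; exact: inner_le.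
Qed.

Let outer_le_inner A V : open V -> A `<=` V -> outer A <= inner V.
Proof. by move=> oV AV; apply: ereal_inf_lbound; exists V. Qed.

Let lambda_bigU_le (f : nat -> set S) n : (forall i, compact (f i)) ->
  (lambda (\bigcup_(i < n) f i) <= \sum_(0 <= i < n) lambda (f i))%R.
Proof.
move=> cf; elim: n => [|n IH].
  by rewrite bigcup_mkord !big_ord0 big_geq// lambda0.
rewrite bigcup_mkord big_ord_recr/= -bigcup_mkord big_nat_recr//=.
apply: le_trans; first apply: lambdaU_le => //.
  by rewrite bigcup_mkord; exact: bigsetU_compact.
by rewrite lerD2r.
Qed.

(** A compact set covered by open sets is covered by compact pieces, one in
    each of finitely many of the open sets. *)
Let compact_split (K : set S) (V : nat -> set S) :
  compact K -> (forall n, open (V n)) -> K `<=` \bigcup_n V n ->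
  exists n (f : nat -> set S), [/\ forall i, compact (f i),
    forall i, f i `<=` V i & K `<=` \bigcup_(i < n) f i].
Proof.
move=> cK oV KV.
apply: (@compact_induction _ K (fun B => exists n (f : nat -> set S),
  [/\ forall i, compact (f i), forall i, f i `<=` V i &
      B `<=` \bigcup_(i < n) f i])) => //.
- exists 0%N, (fun=> set0).
  by split; [move=> i; exact: compact0|move=> i x|move=> x].
- move=> A B AB [n [f [cf fV Bf]]]; exists n, f; split => //.
  exact: subset_trans Bf.
- move=> A B [n [f [cf fV Af]]] [m [g [cg gV Bg]]].
  exists (maxn n m), (fun i => f i `|` g i); split.
  + by move=> i; exact: compactU.
  + by move=> i x [/fV|/gV].
  + move=> x [/Af|/Bg] [i /= im fi]; exists i; rewrite /= ?leq_max ?im ?orbT//.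
      by left.
    by right.
- move=> x Kx; have [n _ Vx] := KV x Kx.
  have [|C [cC xC CV]] := Polish_regular hS (U := V n) (x := x).
    exact: open_nbhs_nbhs.
  exists C => //; exists n.+1, (fun i => if i == n then K `&` C else set0).
  split.
  + by move=> i; case: ifP => _; [exact: compact_closedI|exact: compact0].
  + by move=> i; case: eqP => [-> y [_ /CV]|_].
  + by move=> y ?; exists n; rewrite /= ?eqxx.
Qed.

Let inner_bigcup (V : nat -> set S) : (forall n, open (V n)) ->
  inner (\bigcup_n V n) <= \sum_(n <oo) inner (V n).
Proof.
move=> oV; apply: ge_ereal_sup => _ [K [cK KV] <-].
have [n [f [cf fV Kf]]] := compact_split cK oV KV.
apply: le_trans (@nneseries_lim_ge _ _ xpredT 0 n _); last first.
  by move=> *; exact: inner_ge0.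
apply: (@le_trans _ _ (\sum_(0 <= i < n) (lambda (f i))%:E)).
  rewrite sumEFin lee_fin; apply: le_trans (lambda_bigU_le n cf).
  apply: lambda_le => //.
  by rewrite bigcup_mkord; exact: bigsetU_compact.
by apply: lee_sum => i _; exact: lambda_inner.
Qed.

Let outer_ge0 A : 0 <= outer A.
Proof. by apply: le_ereal_inf_tmp => _ [V _ <-]; exact: inner_ge0. Qed.

Let outer_le1 A : outer A <= 1.
Proof.
by apply: le_trans (inner_le1 setT); apply: outer_le_inner => //; exact: openT.
Qed.

Let outer_fin A : outer A \is a fin_num.
Proof. by rewrite ge0_fin_numE// (le_lt_trans (outer_le1 A))// ltry. Qed.

Let outer0 : outer set0 = 0.
Proof.
apply/eqP; rewrite eq_le outer_ge0 andbT outer_inner; last exact: open0.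
apply: ge_ereal_sup => _ [K [_ +] <-]; rewrite subset0 => ->.
by rewrite lambda0.
Qed.

Let outer_le : {homo outer : A B / A `<=` B >-> A <= B}.
Proof.
move=> A B AB; apply: le_ereal_inf_tmp => _ [V [oV BV] <-].
by apply: outer_le_inner => //; exact: subset_trans BV.
Qed.

Let outer_sigma_subadditive : sigma_subadditive outer.
Proof.
move=> A; apply/lee_addgt0Pr => e e0.
have /choice[V VP] : forall n, exists V, [/\ open V, A n `<=` V &
    inner V <= outer (A n) + (e / (2 ^ n.+1)%:R)%:E].
  move=> n; have en : (0 < e / (2 ^ n.+1)%:R)%R.
    by rewrite divr_gt0// ltr0n expn_gt0.
  have [_ [V [oV AV] <-] Ve] := lb_ereal_inf_adherent en (outer_fin (A n)).
  by exists V; split => //; exact: ltW.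
apply: le_trans (epsilon_trick xpredT _ (ltW e0)); last first.
  by move=> n; exact: outer_ge0.
apply: (@le_trans _ _ (\sum_(n <oo) inner (V n))).
  apply: le_trans (inner_bigcup _); last by move=> n; have [] := VP n.
  apply: outer_le_inner; first by apply: bigcup_open => n _; have [] := VP n.
  by move=> x [n _ Ax]; exists n => //; have [_ + _] := VP n; exact.
by apply: lee_nneseries => // n _; have [] := VP n.
Qed.

HB.instance Definition _ := isOuterMeasure.Build R S outer
  outer0 outer_ge0 outer_le outer_sigma_subadditive.

(** Exhaust W by two disjoint compact sets: K inside the part of W in V, then L
    inside the open set W minus K, which contains the part of W outside V. *)
Let outer_open_caratheodory V : open V -> outer.-caratheodory V.
Proof.
move=> oV; apply: le_caratheodory_measurable => X.
apply: le_ereal_inf_tmp => _ [W [oW XW] <-].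
apply/lee_addgt0Pr => e e0; have e2 : (0 < e / 2)%R by rewrite divr_gt0.
have [K [cK KW Ke]] := inner_adherent (W `&` V) e2.
have cK' : closed K by apply: compact_closed cK; exact: (Polish_hausdorff hS).
have [L [cL LW Le]] := inner_adherent (W `&` ~` K) e2.
apply: (@le_trans _ _ (inner (W `&` V) + inner (W `&` ~` K))).
  apply: leeD; apply: outer_le_inner.
  - exact: openI.
  - exact: setSI.
  - by apply: openI => //; exact: closed_openC.
  - by move=> x [/XW Wx Vx]; split => // /KW[].
apply: (@le_trans _ _
  ((lambda K)%:E + (e / 2)%:E + ((lambda L)%:E + (e / 2)%:E))).
  exact: leeD.
apply: (@le_trans _ _ ((lambda (K `|` L))%:E + e%:E)).
  rewrite lambdaU//; first by rewrite -!EFinD lee_fin; lra.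
  by apply/seteqP; split => // x [Kx /LW[_]]; apply.
apply: leeD => //; apply: lambda_inner; first exact: compactU.
by move=> x [/KW[]|/LW[]].
Qed.

Let borel_caratheodory (A : set (borel S)) :
  measurable A -> outer.-caratheodory A.
Proof.
apply: smallest_sub; last exact: outer_open_caratheodory.
split.
- exact: caratheodory_measurable_set0.
- by move=> B; rewrite setTD; exact: caratheodory_measurable_setC.
- by move=> F mF; exact: caratheodory_measurable_bigcup.
Qed.

Let P (A : set (borel S)) : \bar R := outer A.

Let P0 : P set0 = 0. Proof. exact: outer0. Qed.

Let P_ge0 A : 0 <= P A. Proof. exact: outer_ge0. Qed.

Let P_sigma_additive : semi_sigma_additive P.
Proof.
move=> F mF tF mUF.
apply: (@caratheodory_measure_sigma_additive R S outer F) => //.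
  by move=> n; exact: borel_caratheodory.
exact: borel_caratheodory.
Qed.

HB.instance Definition _ := isMeasure.Build _ _ _ P P0 P_ge0 P_sigma_additive.

Let P_setT : P setT = 1.
Proof.
apply/eqP; rewrite eq_le outer_le1 /P outer_inner; last exact: openT.
apply/lee_addgt0Pr => e e0; have [K cK Ke] := lambda_tight e0.
apply: (@le_trans _ _ ((lambda K)%:E + e%:E)).
  by rewrite -EFinD lee_fin; lra.
by apply: leeD => //; exact: lambda_inner.
Qed.

HB.instance Definition _ := Measure_isProbability.Build _ _ _ P P_setT.

Lemma content_extension : exists P : probability (borel S) R,
  forall A : set (borel S), P A = ereal_inf [set
    ereal_sup [set (lambda K)%:E | K in [set K | compact K /\ K `<=` V]] |
    V in [set V : set S | open V /\ A `<=` V]].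
Proof. by exists P. Qed.

End compact_content.

(** Prokhorov's theorem with an ultrafilter in place of a subsequence. Along an
    ultrafilter every bounded family of reals converges, so the measures of
    each Borel set have a limit L; L is only finitely additive, but its values
    on compact sets form a content. The inequality on closed sets is the part
    of the portmanteau theorem that passes dominance to the limit. *)
Section tight_limit.
Context (R : realType) (S : ptopologicalType) (hS : Polish R S).
Context (I : Type) (G : set_system I) (GU : UltraFilter G).
Variable mu : I -> probability (borel S) R.
Hypothesis mu_tight : forall e : R, 0 < e ->
  exists2 K : set S, compact K & forall i, (mu i (~` K) <= e%:E)%E.

Let m i (A : set (borel S)) : R := fine (mu i A).

Let mE i A : measurable A -> mu i A = (m i A)%:E.
Proof. by move=> mA; rewrite fineK// fin_num_measure. Qed.

Let m_bound i (A : set (borel S)) : measurable A -> 0 <= m i A <= 1.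
Proof.
by move=> mA; rewrite -!lee_fin -mE// measure_ge0 probability_le1.
Qed.

Let lim_m (A : set (borel S)) : exists l : R,
  measurable A -> m i A @[i --> G] --> l.
Proof.
have [mA|mA] := pselect (measurable A); last by exists 0.
have [//|l ml] := @ultra_cvg_segment R I G (m ^~ A) 0 1 GU.
  by move=> i; exact: m_bound.
by exists l.
Qed.

Let L (A : set (borel S)) : R := projT1 (cid (lim_m A)).

Let cvg_L A : measurable A -> m i A @[i --> G] --> L A.
Proof. by rewrite /L; case: cid. Qed.

Let L_ge A (r : R) : measurable A ->
  (\forall i \near G, r <= m i A) -> r <= L A.
Proof.
move=> mA rA; apply: (@closed_cvg _ _ G _ (m ^~ A) (fun x : R => r <= x)) => //.
exact: cvg_L.
Qed.

Let L_le1 A : measurable A -> L A <= 1.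
Proof.
move=> mA; apply: (@closed_cvg _ _ G _ (m ^~ A) (fun x : R => x <= 1)) => //.
- by apply: nearW => i; have /andP[] := m_bound i mA.
- exact: cvg_L.
Qed.

Let L_ge0 A : measurable A -> 0 <= L A.
Proof.
move=> mA; apply: L_ge => //; apply: nearW => i.
by have /andP[] := m_bound i mA.
Qed.

Let LU A B : measurable A -> measurable B -> A `&` B = set0 ->
  L (A `|` B) = L A + L B.
Proof.
move=> mA mB AB.
apply: (@cvg_unique R^o (@Rhausdorff R) (m i (A `|` B) @[i --> G])).
  by apply: cvg_L; exact: measurableU.
have -> : (fun i => m i (A `|` B)) = m ^~ A \+ m ^~ B.
  apply/funext => i /=; apply: EFin_inj; rewrite EFinD -!mE//.
    exact: measureU.
  exact: measurableU.
by apply: cvgD; exact: cvg_L.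
Qed.

Let L_le A B : measurable A -> measurable B -> A `<=` B -> L A <= L B.
Proof.
move=> mA mB AB; have mBA := measurableD mB mA.
by rewrite -(setDUK AB) LU ?lerDl ?L_ge0// setDE setICA setICr setI0.
Qed.

Lemma tight_ultrafilter_limit : exists P : probability (borel S) R,
  forall (C : set S) (r : R), closed C ->
    (\forall i \near G, (r%:E <= mu i C)%E) -> (r%:E <= P C)%E.
Proof.
have mK (K : set S) : compact K -> measurable (K : set (borel S)).
  move=> cK; apply: closed_borel; apply: compact_closed cK.
  exact: (Polish_hausdorff hS).
have LU_le A B : measurable A -> measurable B -> L (A `|` B) <= L A + L B.
  move=> mA mB; have mBA := measurableD mB mA.
  rewrite (_ : A `|` B = A `|` (B `\` A)); last first.
    apply/seteqP; split => x; last by case => [|[? _]]; [left|right].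
    by have [Ax _|nAx [//|Bx]] := pselect (A x); [left|right].
  by rewrite LU ?lerD2l ?L_le// setDE setICA setICr setI0.
have L_tight e : 0 < e -> exists2 K, compact K & 1 - e <= L K.
  move=> e0; have [K cK Ke] := mu_tight e0; exists K => //.
  apply: L_ge; first exact: mK.
  apply: nearW => i; rewrite -lee_fin -mE; last exact: mK.
  have := Ke i; rewrite probability_setC; last exact: mK.
  by rewrite mE ?lee_fin; [move: (m i K) => x; lra|exact: mK].
have [||||P PE] := @content_extension R S hS L _ _ _ _ L_tight.
- by move=> K /mK; exact: L_le1.
- by move=> K K' /mK + /mK; exact: L_le.
- by move=> K K' /mK + /mK; exact: LU_le.
- by move=> K K' /mK + /mK; exact: LU.
exists P => C r cC rC; rewrite PE; apply: le_ereal_inf_tmp => _ [V [oV CV] <-].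
(* Closed sets are handled through their intersection with a compact set that
   carries almost all the mass, uniformly along the family. *)
apply/lee_addgt0Pr => e e0; have [K cK Ke] := mu_tight e0.
have cCK : compact (K `&` C) by exact: compact_closedI.
apply: (@le_trans _ _ ((L (K `&` C))%:E + e%:E)%E); last first.
  apply: leeD => //; apply: ereal_sup_ubound; exists (K `&` C) => //.
  by split => // x [_ /CV].
rewrite -EFinD lee_fin -lerBlDr; apply: L_ge; first exact: mK.
apply: filterS rC => i rC; rewrite lerBlDr -lee_fin EFinD -mE; last exact: mK.
apply: (le_trans rC); apply: (@le_trans _ _ (mu i ((K `&` C) `|` ~` K))).
  rewrite le_measure ?inE//; first exact: closed_borel.
    by apply: measurableU; [exact: mK|apply: measurableC; exact: mK].
  by move=> x Cx; have [Kx|] := pselect (K x); [left|right].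
apply: le_trans; first apply: measureU2.
- exact: mK.
- by apply: measurableC; exact: mK.
- by apply: leeD; last exact: Ke.
Qed.

End tight_limit.

(** * Closed relations and saturated sets *)

(** Every fact about up-sets is needed for down-sets too: the relation r below
    will be the order or its converse. *)
Section relations.
Context (T : Type) (r : T -> T -> Prop).

Definition saturated (A : set T) := forall x y, A x -> r x y -> A y.

Definition saturation (K : set T) := [set y | exists2 x, K x & r x y].

Lemma sub_saturation K : (forall x, r x x) -> K `<=` saturation K.
Proof. by move=> rr x Kx; exists x. Qed.

Lemma saturation_saturated K :
  (forall x y z, r x y -> r y z -> r x z) -> saturated (saturation K).
Proof. by move=> rt x y [z Kz zx] xy; exists z => //; exact: rt xy. Qed.

Lemma saturation_sub K A : saturated A -> K `<=` A -> saturation K `<=` A.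
Proof. by move=> sA KA y [x /KA Ax]; exact: sA. Qed.

End relations.

(** The relation has closed graph, expressed by neighbourhoods of the two
    coordinates. *)
Definition closed_rel (T : topologicalType) (r : T -> T -> Prop) :=
  forall x y, ~ r x y -> exists V W : set T,
    [/\ nbhs x V, nbhs y W & forall v w, V v -> W w -> ~ r v w].

Lemma closed_rel_flip (T : topologicalType) (r : T -> T -> Prop) :
  closed_rel r -> closed_rel (fun x y => r y x).
Proof.
move=> cr x y /cr[V [W [Vx Wy VW]]]; exists W, V; split => // v w Wv Vw.
exact: VW.
Qed.

(** For y outside, each point of K has a neighbourhood none of whose points is
    related to anything near y; compactness of K makes one neighbourhood of y
    work for all of K. *)
Lemma closed_saturation (T : topologicalType) (r : T -> T -> Prop) (K : set T) :
  closed_rel r -> compact K -> closed (saturation r K).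
Proof.
move=> cr cK y cly; apply: contrapT => nKy.
suff [W Wy KW] : exists2 W, nbhs y W & forall x w, K x -> W w -> ~ r x w.
  by have [w [[x Kx xw] Ww]] := cly W Wy; exact: KW xw.
apply: (@compact_induction _ K (fun B => exists2 W, nbhs y W &
    forall x w, B x -> W w -> ~ r x w)) => //.
- by exists setT => //; exact: filterT.
- by move=> A B AB [W Wy BW]; exists W => // x w /AB; exact: BW.
- move=> A B [V Vy AV] [W Wy BW]; exists (V `&` W); first exact: filterI.
  by move=> x w [Ax|Bx] [Vw Ww]; [exact: AV|exact: BW].
- move=> x Kx; have [|V [W [Vx Wy VW]]] := cr x y.
    by move=> xy; apply: nKy; exists x.
  by exists V => //; exists W => // x' w [_ Vx']; exact: VW.
Qed.

(** * Stochastic dominance *)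

Section ordered_Polish.
Context (R : realType) (d : Order.disp_t) (S : poPTopologicalType d).
Hypotheses (hS : Polish R S) (hle : closed_order S).
Implicit Types p q : prob R S.

(** The order is assumed to be sequentially closed, which is enough because
    points have countable neighbourhood bases. *)
Lemma closed_order_rel : closed_rel (fun x y : S => (x <= y)%O).
Proof.
move=> x y xy; have [B [Bx Bcvg]] := Polish_first_countable hS x.
have [C [Cy Ccvg]] := Polish_first_countable hS y.
apply: contrapT => nVW.
have /choice[vw vwP] : forall n, exists vw : S * S,
    [/\ B n vw.1, C n vw.2 & (vw.1 <= vw.2)%O].
  move=> n; apply: contrapT => nvw; apply: nVW.
  exists (B n), (C n); split => //.
  by move=> v w Bv Cw vw; apply: nvw; exists (v, w).
apply: xy; apply: (hle (x := fun n => (vw n).1) (y := fun n => (vw n).2)).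
- by move=> n; have [] := vwP n.
- by apply: Bcvg => n; have [] := vwP n.
- by apply: Ccvg => n; have [] := vwP n.
Qed.

Lemma compact_Borel (K : set S) : compact K -> measurable (K : set (borel S)).
Proof.
move=> cK; apply: closed_borel; apply: compact_closed cK.
exact: Polish_hausdorff hS.
Qed.

(** Inner regularity reduces a Borel saturated set A to compact K inside A, and
    the saturation of K is a closed saturated set between the two. *)
Lemma saturated_closed_le (r : S -> S -> Prop) p q :
  (forall x, r x x) -> (forall x y z, r x y -> r y z -> r x z) ->
  closed_rel r ->
  (forall C : set S, closed C -> saturated r C -> (p C <= q C)%E) ->
  forall A : set (borel S), measurable A -> saturated r A -> (p A <= q A)%E.
Proof.
move=> rr rt rc pq A mA sA; apply/lee_addgt0Pr => e e0.
have [K [cK KA Ke]] := Borel_compact_inner hS p mA e0.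
apply: (le_trans Ke); apply: leeD => //.
have cKr := closed_saturation rc cK.
apply: (@le_trans _ _ (p (saturation r K))).
  apply: le_measure; rewrite ?inE; first exact: compact_Borel.
    exact: closed_borel.
  exact: sub_saturation.
apply: (le_trans (pq _ cKr (saturation_saturated rt))).
apply: le_measure; rewrite ?inE//; first exact: closed_borel.
exact: saturation_sub.
Qed.

Lemma ib_integrable p (h : S -> R) : ib h ->
  p.-integrable setT (EFin \o (h : borel S -> R)).
Proof.
move=> [[M hM] mh _]; apply: measurable_bounded_integrable => //.
  by rewrite (le_lt_trans (probability_le1 _ _))// ltry.
exists M; split; first exact: num_real.
by move=> z Mz x _; exact: le_trans (hM x) (ltW Mz).
Qed.

Lemma ib_indic (A : set (borel S)) : measurable A ->
  saturated (fun x y : S => (x <= y)%O) A -> ib (\1_A : S -> R).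
Proof.
move=> mA sA; split.
- by exists 1 => x; rewrite indicE; case: (x \in A); rewrite ?normr1 ?normr0.
- exact: measurable_indic.
- move=> x y xy; rewrite !indicE; have [/set_mem Ax|_] := boolP (x \in A).
    by rewrite mem_set//; exact: sA Ax xy.
  by rewrite ler0n.
Qed.

Lemma expect_indic p (A : set (borel S)) : measurable A ->
  expect p \1_A = fine (p A).
Proof. by move=> mA; rewrite /expect /Rintegral integral_indic// setIT. Qed.

(** Left to right, indicators of up-sets are increasing. Right to left, after
    adding a constant that makes h nonnegative, its expectation is the integral
    over t of the probability of the up-set where it exceeds t. *)
Lemma sd_upset p q : sd p q <-> forall A : set (borel S), measurable A ->
  saturated (fun x y : S => (x <= y)%O) A -> (p A <= q A)%E.
Proof.
split=> [pq A mA sA|pq h hib]; last have [[M hM] mh ih] := hib.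
  have := pq _ (ib_indic mA sA); rewrite !expect_indic// => pqA.
  rewrite -(fineK (fin_num_measure p A mA)) -(fineK (fin_num_measure q A mA)).
  by rewrite lee_fin.
pose g : borel S -> R := fun x => h x + M.
have mg : measurable_fun setT g by apply: measurable_funD.
pose X : {mfun borel S >-> R} := mfun_Sub (mem_set mg).
have X0 x : 0 <= X x.
  by rewrite /= /g; have := hM x; rewrite ler_norml => /andP[]; lra.
have Eh (u : prob R S) : ('E_u[X] = (expect u h + M)%:E)%E.
  have ih' := ib_integrable u hib.
  have iM : u.-integrable setT (EFin \o (cst M : borel S -> R)).
    exact: finite_measure_integrable_cst.
  have -> : expect u h + M = \int[u]_x g x.
    have u1 : fine (u [set: borel S]) = 1 by rewrite probability_setT.
    by rewrite RintegralD// Rintegral_cst// u1 mulr1.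
  rewrite expectation_def /Rintegral fineK//.
  by apply: integrable_fin_num => //; exact: (integrableD measurableT ih' iM).
have : ('E_p[X] <= 'E_q[X])%E.
  rewrite !ge0_expectation_ccdf//; apply: ge0_le_integral => //.
  - by apply: measurable_funTS; exact: (@ccdf_measurable _ _ _ p X).
  - by apply: measurable_funTS; exact: (@ccdf_measurable _ _ _ q X).
  - move=> t _; apply: pq.
      by rewrite -[X in measurable X]setTI; exact: measurable_funP.
    move=> x y; rewrite /= !in_itv/= !andbT => tx xy.
    by apply: lt_le_trans tx _; rewrite lerD2r; exact: ih.
by rewrite !Eh lee_fin lerD2r.
Qed.

Lemma sd_downset p q : sd p q <-> forall A : set (borel S), measurable A ->
  saturated (fun x y : S => (y <= x)%O) A -> (q A <= p A)%E.
Proof.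
rewrite sd_upset; split=> pq A mA sA; have mAC := measurableC mA;
  rewrite -(setCK A) !(probability_setC _ mAC); apply: leeB => //;
  apply: pq => // x y nAx xy Ay; apply: nAx; exact: sA xy.
Qed.

End ordered_Polish.

(** * Antisymmetry of dominance *)

(** Two probabilities that dominate each other agree on Borel up-sets, a
    family stable under intersection, hence on the sigma-algebra it generates.
    This sigma-algebra separates disjoint compact sets, and by inner regularity
    agreement on it forces equality. *)
Section antisymmetry.
Context (R : realType) (d : Order.disp_t) (S : poPTopologicalType d).
Hypotheses (hS : Polish R S) (hle : closed_order S).

Definition Borel_upsets : set (set S) :=
  [set A : set S | measurable (A : set (borel S)) /\
    saturated (fun x y : S => (x <= y)%O) A].

(** Two distinct points x and y are not related in one of the two directions.
    If x <= y fails, the up-set generated by a compact neighbourhood (in K) of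
    x misses a neighbourhood of y; if y <= x fails, the complement of the
    up-set generated by a compact neighbourhood (in K') of y plays that role. *)
Lemma sigma_upsets_separate_point (K K' : set S) (x : S) :
  compact K -> compact K' -> K x -> K `&` K' = set0 ->
  exists U A, [/\ nbhs x U, <<s Borel_upsets >> A, K `&` U `<=` A &
    A `&` K' = set0].
Proof.
move=> cK cK' Kx KK'.
have sat_sigma (L : set S) : compact L ->
    <<s Borel_upsets >> (saturation (fun x y : S => (x <= y)%O) L).
  move=> cL; apply: sub_sigma_algebra; split.
    apply: closed_borel; apply: closed_saturation cL.
    exact: (closed_order_rel hS hle).
  by apply: saturation_saturated => a b c; exact: le_trans.
apply: (@compact_induction _ K' (fun B => exists U A,
  [/\ nbhs x U, <<s Borel_upsets >> A, K `&` U `<=` A & A `&` B = set0])) => //.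
- exists setT, setT; split; [exact: filterT| |by []|exact: setI0].
  exact: (@measurableT _ (g_sigma_algebraType Borel_upsets)).
- move=> B C BC [U [A [Ux sA KUA AC]]]; exists U, A; split => //.
  by apply/seteqP; split => // z [Az /BC Cz]; rewrite -AC.
- move=> B C [U [A [Ux sA KUA AB]]] [V [A' [Vx sA' KVA A'C]]].
  exists (U `&` V), (A `&` A'); split.
  + exact: filterI.
  + exact: (@measurableI _ (g_sigma_algebraType Borel_upsets)).
  + by move=> z [Kz [Uz Vz]]; split; [exact: KUA|exact: KVA].
  + apply/seteqP; split => // z [[Az A'z] [Bz|Cz]]; first by rewrite -AB.
    by rewrite -A'C.
- move=> y K'y; have [xy|xy] := pselect (x <= y)%O; last first.
    have [V [W [Vx Wy VW]]] := closed_order_rel hS hle xy.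
    have [C [cC Cx CV]] := Polish_regular hS Vx.
    exists W => //.
    exists C, (saturation (fun x y : S => (x <= y)%O) (K `&` C)); split => //.
    + by apply: sat_sigma; exact: compact_closedI.
    + exact: sub_saturation.
    + apply/seteqP; split => // w [[v [_ Cv] vw] [_ Ww]].
      exact: (VW v w (CV _ Cv)).
have yx : ~ (y <= x)%O.
  move=> yx; have exy : x = y by apply/eqP; rewrite eq_le xy yx.
  by have : set0 x by rewrite -KK'; split => //; rewrite exy.
have [V [W [Vy Wx VW]]] := closed_order_rel hS hle yx.
have [C [cC Cy CV]] := Polish_regular hS Vy.
exists C => //.
exists W, (~` saturation (fun x y : S => (x <= y)%O) (K' `&` C)); split => //.
+ rewrite -setTD; apply: sigma_algebraCD; apply: sat_sigma.
  exact: compact_closedI.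
+ by move=> w [_ Ww] [v [_ Cv] vw]; exact: (VW v w (CV _ Cv)).
+ apply/seteqP; split => // z [nz K'z]; apply: nz; exact: sub_saturation.
Qed.

Lemma sigma_upsets_separate (K K' : set S) :
  compact K -> compact K' -> K `&` K' = set0 ->
  exists A, [/\ <<s Borel_upsets >> A, K `<=` A & A `&` K' = set0].
Proof.
move=> cK cK' KK'.
apply: (@compact_induction _ K (fun B => exists A,
  [/\ <<s Borel_upsets >> A, B `<=` A & A `&` K' = set0])) => //.
- exists set0; split => //; first exact: sigma_algebra0.
  exact: set0I.
- move=> A B AB [A' [sA' BA' A'K]]; exists A'; split => //.
  exact: subset_trans BA'.
- move=> B C [A [sA BA AK]] [A' [sA' CA' A'K]]; exists (A `|` A'); split.
  + exact: (@measurableU _ (g_sigma_algebraType Borel_upsets)).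
  + exact: setUSS.
  + by rewrite setIUl AK A'K setU0.
- move=> x Kx.
  have [U [A [Ux sA KUA AK]]] := sigma_upsets_separate_point cK cK' Kx KK'.
  by exists U => //; exists A.
Qed.

Lemma sigma_upsets_measurable (A : set (borel S)) :
  <<s Borel_upsets >> A -> measurable A.
Proof.
apply: smallest_sub; last by move=> B [].
exact: sigma_algebra_measurable.
Qed.

Lemma eq_on_sigma_upsets (p q : prob R S) : sd p q -> sd q p ->
  forall A : set (borel S), <<s Borel_upsets >> A -> p A = q A.
Proof.
move=> /sd_upset pq /sd_upset qp A sA.
suff [] : [set A : set (borel S) | measurable A /\ p A = q A] A by [].
move: A sA; apply: lambda_system_subset => //.
- move=> A B [mA sA] [mB sB]; split; first exact: measurableI.
  by move=> x y [Ax Bx] xy; split; [exact: sA xy|exact: sB xy].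
- split=> //.
  + by split => //; rewrite !probability_setT.
  + move=> A B BA [mA pqA] [mB pqB]; split; first exact: measurableD.
    have lty (u : prob R S) : (u A < +oo)%E.
      by rewrite (le_lt_trans (probability_le1 _ _))// ltry.
    rewrite (measureD mA mB (lty p)) (measureD mA mB (lty q)).
    by rewrite (setIidr BA); congr (_ - _)%E.
  + move=> F ndF FH; have mF n : measurable (F n) by have [] := FH n.
    have mUF : measurable (\bigcup_n F n) by exact: bigcup_measurable.
    split => //; apply: (@cvg_unique _ (@ereal_hausdorff R) (p \o F @ \oo)).
      exact: nondecreasing_cvg_mu.
    have -> : p \o F = q \o F.
      by apply/funext => n /=; have [] := FH n.
    exact: nondecreasing_cvg_mu.
- move=> A [mA sA]; split => //; apply/eqP; rewrite eq_le.
  by rewrite pq// qp.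
Qed.

(** With K inside A and K' inside its complement nearly exhausting p and q
    respectively, a set B separating them gives p K <= p B = q B <= 1 - q K',
    that is p A <= q A up to the error made. *)
Lemma sd_antisymmetric (p q : prob R S) : sd p q -> sd q p -> p = q.
Proof.
move=> pq qp.
suff le_pq A : measurable A -> (p A <= q A)%E.
  apply: prob_ext => A mA; apply/eqP; rewrite eq_le le_pq//=.
  have mAC := measurableC mA.
  rewrite -(setCK A) !(probability_setC _ mAC); apply: leeB => //.
  exact: le_pq.
move=> mA; have mAC := measurableC mA; apply/lee_addgt0Pr => e e0.
have e2 : 0 < e / 2 by rewrite divr_gt0.
have [K [cK KA Ke]] := Borel_compact_inner hS p mA e2.
have [K' [cK' K'A K'e]] := Borel_compact_inner hS q mAC e2.
have [|B [sB KB BK']] := sigma_upsets_separate cK cK'.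
  by apply/seteqP; split => // x [/KA Ax /K'A].
have mB := sigma_upsets_measurable sB.
have mK := compact_Borel hS cK; have mK' := compact_Borel hS cK'.
have pB : (p K <= q B)%E.
  by rewrite -(eq_on_sigma_upsets pq qp)// le_measure ?inE.
have qB : (q B <= 1 - q K')%E.
  rewrite -probability_setC// le_measure ?inE//; first exact: measurableC.
  by move=> x Bx K'x; have : set0 x by rewrite -BK'.
move: Ke K'e pB qB; rewrite probability_setC//.
rewrite -(fineK (fin_num_measure p A mA)) -(fineK (fin_num_measure q A mA)).
rewrite -(fineK (fin_num_measure p K mK)) -(fineK (fin_num_measure q K' mK')).
rewrite -(fineK (fin_num_measure q B mB)).
rewrite -!EFinB -!EFinD !lee_fin; lra.
Qed.

End antisymmetry.

(** * Tight families and order bounded families *)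

(** The Poisson distribution is used only as a convenient probability on the
    naturals with all tails positive. *)
Section domination.
Context (R : realType) (d : Order.disp_t) (S : poPTopologicalType d).

Let poisson_tail n : set nat := [set k | (n < k)%N].

Let tail_gt0 n : (0 < @poisson_prob R 1 0 (poisson_tail n))%E.
Proof.
apply: (@lt_le_trans _ _ (@poisson_prob R 1 0 [set n.+1])); last first.
  by apply: le_measure; rewrite ?inE// => _ ->; rewrite /poisson_tail/=.
rewrite /poisson_prob ltr01 esum_set1 ?lee_fin ?poisson_pmf_ge0//.
rewrite /poisson_pmf ltr01 lte_fin.
by rewrite !mulr_gt0 ?expR_gt0 ?invr_gt0 ?ltr0n ?fact_gt0 ?exprn_gt0.
Qed.

Let small_tail (e : R) : 0 < e ->
  exists n, (@poisson_prob R 1 0 (poisson_tail n) <= e%:E)%E.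
Proof.
move=> e0; apply: measure_bigcap_le => //.
- by move=> m n mn; apply/subsetPset => k; exact: leq_ltn_trans.
- rewrite (_ : \bigcap_n _ = set0) ?measure0 ?lte_fin//.
  by apply/seteqP; split => // k /(_ k Logic.I); rewrite /poisson_tail /= ltnn.
Qed.

(** The dominating measure is the image of the Poisson distribution under an
    r-increasing sequence b, chosen so that each p in Phi has no more mass
    outside the r-lower set of b n than the Poisson tail beyond n. If m + 1 is
    the first index with b (m + 1) in the saturated set A, then A misses the
    lower set of b m, so p A is at most the tail beyond m, and all of that tail
    is mapped into A. *)
Lemma dominating_prob (r : S -> S -> Prop) (Phi : set (prob R S)) :
  (forall x, r x x) -> (forall x y z, r x y -> r y z -> r x z) ->
  (forall x y, exists z, r x z /\ r y z) ->
  (forall b, measurable ([set x | r x b] : set (borel S))) ->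
  (forall e : R, 0 < e -> exists b,
     forall p, Phi p -> (p (~` [set x | r x b]) <= e%:E)%E) ->
  exists u : prob R S, forall p, Phi p -> forall A : set (borel S),
    measurable A -> saturated r A -> (p A <= u A)%E.
Proof.
move=> rr rt rdir mr tPhi.
have fin_tail n :=
  fin_num_measure (@poisson_prob R 1 0) (poisson_tail n) Logic.I.
have /choice[c cP] : forall n, exists b, forall p, Phi p ->
    (p (~` [set x | r x b]) <= @poisson_prob R 1 0 (poisson_tail n))%E.
  move=> n; have [|b bP] := tPhi (fine (@poisson_prob R 1 0 (poisson_tail n))).
    by rewrite fine_gt0// tail_gt0 ltey_eq fin_tail.
  by exists b => p /bP; rewrite (fineK (fin_tail n)).
(* The points c n need not be increasing; b n is an r-upper bound of
   c 0, ..., c n built by joining one point at a time. *)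
have /choice[j jP] : forall xy : S * S, exists z, r xy.1 z /\ r xy.2 z.
  by move=> [x y]; exact: rdir.
pose b := fix b n := if n is m.+1 then j (b m, c n) else c 0%N.
have bS n : r (b n) (b n.+1) by have [] := jP (b n, c n.+1).
have b_le m n : (m <= n)%N -> r (b m) (b n).
  move=> /subnK <-; elim: (n - m)%N => [|k]; first exact: rr.
  by move=> /rt; apply; exact: bS.
have cb n : r (c n) (b n).
  by case: n => [|n]; [exact: rr|have [] := jP (b n, c n.+1)].
have mb : measurable_fun [set: nat] (b : nat -> borel S).
  by move=> _ B _; exact: Logic.I.
pose X : {mfun nat >-> borel S} := mfun_Sub (mem_set mb).
exists (prob_of (distribution (@poisson_prob R 1 0) X)) => p Phip A mA sA.
rewrite prob_ofE//= /distribution /pushforward.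
have small n : ~ A (b n) -> (p A <= @poisson_prob R 1 0 (poisson_tail n))%E.
  move=> nA; apply: le_trans (cP n p Phip); apply: le_measure; rewrite ?inE//.
    exact: measurableC.
  move=> x Ax rx; apply: nA; apply: (sA (c n)); last exact: cb.
  exact: sA Ax rx.
have [[n An]|nA] := pselect (exists n, A (b n)); last first.
  apply: (@le_trans _ _ 0%E); last exact: measure_ge0.
  apply/lee_addgt0Pr => e e0; rewrite add0e.
  have [n ne] := small_tail e0.
  by apply: le_trans ne; apply: small => ?; apply: nA; exists n.
have : exists n, `[< A (b n) >] by exists n; exact/asboolP.
move=> /ex_minnP[[|m] /asboolP Am minm].
  apply: (@le_trans _ _ (@poisson_prob R 1 0 setT)).
    by rewrite probability_setT probability_le1.
  by apply: le_measure; rewrite ?inE// => k _; apply: sA Am _; exact: b_le.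
have nAm : ~ A (b m) by move=> /asboolP /minm; rewrite ltnn.
apply: (le_trans (small _ nAm)); apply: le_measure; rewrite ?inE//.
by move=> k mk; apply: sA Am _; exact: b_le.
Qed.

End domination.

Section tight_bounded.
Context (R : realType) (d : Order.disp_t) (S : poPTopologicalType d).
Hypotheses (hS : Polish R S) (hle : closed_order S).
Hypothesis hcompact :
  forall A : set S, compact A <-> closed A /\ order_bounded A.

Lemma closed_lower_ray (b : S) : closed [set x : S | (x <= b)%O].
Proof.
have := closed_saturation (closed_rel_flip (closed_order_rel hS hle))
  (@compact_set1 _ b).
congr closed; apply/seteqP; split => x /=; last by exists b.
by move=> [_ ->].
Qed.

Lemma closed_upper_ray (a : S) : closed [set x : S | (a <= x)%O].
Proof.
have := closed_saturation (closed_order_rel hS hle) (@compact_set1 _ a).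
congr closed; apply/seteqP; split => x /=; last by exists a.
by move=> [_ ->].
Qed.

Lemma compact_itv (a b : S) : (a <= b)%O -> compact [set` `[a, b]%O].
Proof.
move=> ab; apply/hcompact; split; last by exists a, b; split.
rewrite (_ : [set` _] = [set x | (a <= x)%O] `&` [set x | (x <= b)%O]).
  by apply: closedI; [exact: closed_upper_ray|exact: closed_lower_ray].
by apply/seteqP; split => x /=; rewrite in_itv /= => /andP.
Qed.

Lemma compact_bounded (K : set S) : compact K -> exists a b : S,
  (a <= b)%O /\ forall x, K x -> (a <= x)%O /\ (x <= b)%O.
Proof.
move=> /hcompact[_ [a [b [ab Kab]]]]; exists a, b; split => // x /Kab/=.
by rewrite in_itv/= => /andP.
Qed.

Lemma pair_bounded (x y : S) : exists a b : S,
  [/\ (a <= x)%O, (a <= y)%O, (x <= b)%O & (y <= b)%O].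
Proof.
have [a [b [_ Kab]]] := compact_bounded
  (@compactU _ _ _ (@compact_set1 _ x) (@compact_set1 _ y)).
exists a, b.
by have [] := Kab x (or_introl erefl); have [] := Kab y (or_intror erefl).
Qed.

Lemma tight_order_bounded (Phi : set (prob R S)) : tight Phi ->
  exists l u : prob R S, forall p, Phi p -> sd l p /\ sd p u.
Proof.
move=> tPhi.
have mL b : measurable ([set x : S | (x <= b)%O] : set (borel S)).
  by apply: closed_borel; exact: closed_lower_ray.
have mU a : measurable ([set x : S | (a <= x)%O] : set (borel S)).
  by apply: closed_borel; exact: closed_upper_ray.
have [| | | |u uP] :=
    @dominating_prob R d S (fun x y => (x <= y)%O) Phi _ _ _ mL.
- by [].
- by move=> x y z; exact: le_trans.
- by move=> x y; have [a [b []]] := pair_bounded x y; exists b.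
- move=> e e0; have [K cK Ke] := tPhi e e0.
  have [a [b [ab Kab]]] := compact_bounded cK.
  exists b => p /Ke; apply: le_trans.
  apply: le_measure; rewrite ?inE; first exact: measurableC.
    by apply: measurableC; exact: (compact_Borel hS).
  by apply: subsetC => x /Kab[].
have [| | | |l lP] :=
    @dominating_prob R d S (fun x y => (y <= x)%O) Phi _ _ _ mU.
- by [].
- by move=> x y z xy yz; exact: le_trans yz xy.
- by move=> x y; have [a [b []]] := pair_bounded x y; exists a.
- move=> e e0; have [K cK Ke] := tPhi e e0.
  have [a [b [ab Kab]]] := compact_bounded cK.
  exists a => p /Ke; apply: le_trans.
  apply: le_measure; rewrite ?inE; first exact: measurableC.
    by apply: measurableC; exact: (compact_Borel hS).
  by apply: subsetC => x /Kab[].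
exists l, u => p Phip; split; first by apply/sd_downset => A mA; exact: lP.
by apply/sd_upset => A mA; exact: uP.
Qed.

Lemma order_bounded_tight (l u : prob R S) (Phi : set (prob R S)) :
  (forall p, Phi p -> sd l p /\ sd p u) -> tight Phi.
Proof.
move=> bPhi e e0; have e2 : 0 < e / 2 by rewrite divr_gt0.
have [Kl cKl Kle] := Polish_tight hS l e2.
have [Ku cKu Kue] := Polish_tight hS u e2.
have [a [b [ab Kab]]] := compact_bounded (@compactU _ _ _ cKl cKu).
have mL : measurable ([set x : S | (x <= b)%O] : set (borel S)).
  by apply: closed_borel; exact: closed_lower_ray.
have mU : measurable ([set x : S | (a <= x)%O] : set (borel S)).
  by apply: closed_borel; exact: closed_upper_ray.
have mLC := measurableC mL; have mUC := measurableC mU.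
exists [set` `[a, b]%O]; first exact: compact_itv.
move=> p /bPhi[/sd_downset lp /sd_upset pu].
apply: (@le_trans _ _
  (p (~` [set x : S | (a <= x)%O] `|` ~` [set x : S | (x <= b)%O]))).
  apply: le_measure; rewrite ?inE.
  - by apply: measurableC; apply: (compact_Borel hS); exact: compact_itv.
  - exact: measurableU.
  - by rewrite -setCI; apply: subsetC => x [/= ax xb]; rewrite in_itv/= ax xb.
apply: le_trans; first exact: measureU2.
rewrite (splitr e) EFinD; apply: leeD.
- apply: (@le_trans _ _ (l (~` [set x : S | (a <= x)%O]))).
    apply: lp => // x y /= ax yx ay; apply: ax; exact: le_trans ay yx.
  apply: le_trans Kle; apply: le_measure; rewrite ?inE//.
    by apply: measurableC; exact: (compact_Borel hS).
  by apply: subsetC => x Kx; have [] := Kab x (or_introl Kx).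
- apply: (@le_trans _ _ (u (~` [set x : S | (x <= b)%O]))).
    by apply: pu => // x y /= xb xy yb; apply: xb; exact: le_trans xy yb.
  apply: le_trans Kue; apply: le_measure; rewrite ?inE//.
    by apply: measurableC; exact: (compact_Borel hS).
  by apply: subsetC => x Kx; have [] := Kab x (or_intror Kx).
Qed.

End tight_bounded.

(** * The Bhattacharya metric *)

Section Bhattacharya.
Context (R : realType) (d : Order.disp_t) (S : poPTopologicalType d).
Implicit Types p q l u : prob R S.

Lemma expect_bound p (h : S -> R) : ib h -> (forall x, `|h x| <= 1) ->
  `|expect p h| <= 1.
Proof.
move=> ih h1; have int_h := ib_integrable p ih.
have int1 := finite_measure_integrable_cst p (1 : R) (@measurableT _ (borel S)).
apply: le_trans; first exact: le_normr_Rintegral.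
have p1 : fine (p [set: borel S]) = 1 by rewrite probability_setT.
have E1 : \int[p]_(x in [set: borel S]) (1 : R) = 1.
  by rewrite Rintegral_cst// p1 mulr1.
rewrite -[leRHS]E1; apply: le_Rintegral => //.
exact: integrable_norm.
Qed.

Lemma bhattacharya_ge p q (h : S -> R) : ib h -> (forall x, `|h x| <= 1) ->
  `|expect p h - expect q h| <= bhattacharya p q.
Proof.
move=> ih h1; apply: sup_upper_bound; last by exists h.
split; first by exists `|expect p h - expect q h|, h.
exists 2 => _ [g [ig g1] <-].
apply: le_trans (ler_normB _ _) _; have := expect_bound p ig g1.
by have := expect_bound q ig g1; lra.
Qed.

Lemma ib0 : ib (cst 0 : S -> R).
Proof. by split => //; exists 0 => x; rewrite normr0. Qed.

Lemma bhattacharya_le p q (c : R) :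
  (forall h, ib h -> (forall x, `|h x| <= 1) ->
    `|expect p h - expect q h| <= c) ->
  bhattacharya p q <= c.
Proof.
move=> hc; apply: ge_sup; last by move=> _ [h [ih h1] <-]; exact: hc.
exists `|expect p (cst 0) - expect q (cst 0)|, (cst 0) => //.
by split; [exact: ib0|move=> x; rewrite normr0].
Qed.

Lemma bhattacharya_ge0 p q : 0 <= bhattacharya p q.
Proof.
apply: le_trans (bhattacharya_ge p q ib0 _); first exact: normr_ge0.
by move=> x; rewrite normr0.
Qed.

Lemma bhattacharya_triangle p q u :
  bhattacharya p q <= bhattacharya p u + bhattacharya q u.
Proof.
apply: bhattacharya_le => h ih h1.
apply: le_trans (ler_distD (expect u h) _ _) _.
by apply: lerD; [|rewrite distrC]; exact: bhattacharya_ge.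
Qed.

(** For increasing h both expectations lie between those under l and u, so
    beta measures the size of order intervals. *)
Lemma bhattacharya_sandwich l p q u : sd l p -> sd p u -> sd l q -> sd q u ->
  bhattacharya p q <= bhattacharya l u.
Proof.
move=> lp pu lq qu; apply: bhattacharya_le => h ih h1.
apply: le_trans (bhattacharya_ge l u ih h1).
have := (lp h ih, pu h ih, lq h ih, qu h ih) => -[[[? ?] ?] ?].
rewrite ler_norml; apply/andP.
have : expect u h - expect l h <= `|expect l h - expect u h|.
  by rewrite distrC ler_norm.
by split; lra.
Qed.

Lemma bhattacharya_eq (hS : Polish R S) (hle : closed_order S) p q :
  bhattacharya p q <= 0 -> p = q.
Proof.
move=> pq0; have eqA (A : set (borel S)) : measurable A ->
    saturated (fun x y : S => (x <= y)%O) A -> p A = q A.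
  move=> mA sA.
  have : `|expect p \1_A - expect q \1_A| <= 0.
    apply: le_trans pq0; apply: bhattacharya_ge; first exact: ib_indic.
    by move=> x; rewrite indicE; case: (x \in A); rewrite ?normr1 ?normr0.
  rewrite normr_le0 subr_eq0 !expect_indic// => /eqP pqA.
  by rewrite -(fineK (fin_num_measure p A mA)) pqA fineK// fin_num_measure.
by apply: (sd_antisymmetric hS hle); apply/sd_upset => A mA sA; rewrite eqA.
Qed.

End Bhattacharya.

(** * Time *)

Section semigroup_time.
Context (R : realType) (TT : set R).
Hypothesis hTT : TT = time_continuous R \/ TT = time_discrete R.

Lemma time0 : TT 0.
Proof. by case: hTT => ->; [rewrite /time_continuous /=|exists 0%N]. Qed.

Lemma timeB s t : TT s -> TT t -> s <= t -> TT (t - s).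
Proof.
case: hTT => ->; first by rewrite /time_continuous /= subr_ge0.
move=> [m _ <-] [n _ <-]; rewrite ler_nat => mn.
by exists (n - m)%N => //; rewrite natrB.
Qed.

Lemma time_unbounded (M : R) : exists2 t, TT t & M < t.
Proof.
case: hTT => ->.
  exists (Num.max M 0 + 1); last by rewrite ltr_pwDr// le_max lexx.
  by rewrite /time_continuous /= addr_ge0// le_max lexx orbT.
exists (Num.bound `|M|)%:R; first by exists (Num.bound `|M|).
by rewrite (le_lt_trans (ler_norm M))// archi_boundP.
Qed.

Lemma time_filter_proper : ProperFilter (within TT (pinfty_nbhs R)).
Proof.
apply: Build_ProperFilter_ex => A [M [_ MA]].
by have [t TTt Mt] := time_unbounded M; exists t; exact: MA.
Qed.

Lemma time_near s : within TT (pinfty_nbhs R) [set t | TT t /\ s <= t].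
Proof.
exists s; split; first exact: num_real.
by move=> t st TTt; split => //; exact: ltW.
Qed.

Lemma time_cvg0_lt (f : R -> R) (e M : R) : 0 < e ->
  f t @[t --> within TT (pinfty_nbhs R)] --> 0 ->
  exists t, [/\ TT t, M <= t & f t < e].
Proof.
move=> e0 f0; have PF := time_filter_proper.
have fe : \forall t \near within TT (pinfty_nbhs R), f t < e.
  exact: cvgr_lt f0 _ e0.
have [t [/= fte [TTt Mt]]] := filter_ex (filterI fe (time_near M)).
by exists t.
Qed.

End semigroup_time.

(** * Global stability *)

Section stability.
Context (R : realType) (d : Order.disp_t) (S : poPTopologicalType d).
Hypotheses (hS : Polish R S) (hle : closed_order S).
Hypothesis hcompact :
  forall A : set S, compact A <-> closed A /\ order_bounded A.
Context (TT : set R) (T : R -> prob R S -> prob R S).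
Hypothesis hTT : TT = time_continuous R \/ TT = time_discrete R.
Hypotheses (hT : semigroup TT T) (hmono : order_preserving TT T).

Let T_split s t : TT s -> TT t -> s <= t -> forall p, T t p = T s (T (t - s) p).
Proof.
move=> TTs TTt st p; have [_ Tadd] := hT.
by rewrite -Tadd ?subrKC//; exact: timeB.
Qed.

Lemma globally_stable_contractive :
  globally_stable TT T -> asymptotically_contractive TT T.
Proof.
move=> [phis [_ _ cphis]] p q; have PF := time_filter_proper hTT.
apply: (@squeeze_cvgr _ _ _ _ (cst 0) (fun t =>
  bhattacharya (T t p) phis + bhattacharya (T t q) phis)).
- by apply: nearW => t; rewrite bhattacharya_ge0 bhattacharya_triangle.
- exact: cvg_cst.
- by rewrite -(addr0 0); apply: cvgD; exact: cphis.
Qed.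

Lemma globally_stable_bounded :
  globally_stable TT T -> order_bounded_trajectory TT T.
Proof.
move=> [phis [sphis _ _]]; exists phis, phis, phis => t TTt.
by rewrite sphis//; split => h _.
Qed.

Lemma order_bounded_trajectory_tight (p l u : prob R S) :
  (forall t, TT t -> sd l (T t p) /\ sd (T t p) u) ->
  tight [set T t p | t in TT].
Proof.
move=> lpu; apply: (order_bounded_tight hS hle hcompact (l := l) (u := u)).
by move=> _ [t TTt <-]; exact: lpu.
Qed.

(** The limit phis is taken along an ultrafilter finer than t -> +oo; from time
    s on, T t p lies between T s l and T s u, and dominance, tested on closed
    up-sets and closed down-sets, survives the limit. *)
Lemma trajectory_limit (p l u : prob R S) :
  (forall t, TT t -> sd l (T t p) /\ sd (T t p) u) ->
  exists phis : prob R S, forall s, TT s -> sd (T s l) phis /\ sd phis (T s u).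
Proof.
move=> lpu; have PF := time_filter_proper hTT.
have [G [GU sG]] := ultraFilterLemma PF.
(* Times outside TT are sent to 0 so that the whole family indexed by R is
   tight; the ultrafilter does not see them. *)
pose mu t : probability (borel S) R := T (if `[< TT t >] then t else 0) p.
have TTif t : TT (if `[< TT t >] then t else 0).
  by case: asboolP => // _; exact: time0.
have tmu (e : R) : 0 < e ->
    exists2 K : set S, compact K & forall t, (mu t (~` K) <= e%:E)%E.
  move=> /(order_bounded_trajectory_tight lpu)[K cK Ke]; exists K => // t.
  by apply: Ke; exists (if `[< TT t >] then t else 0).
have [P PG] := tight_ultrafilter_limit hS GU tmu.
exists (prob_of P) => s TTs.
have near_G (C : set S) (q : prob R S) : closed C ->
    (forall t, TT t -> s <= t -> (q C <= T t p C)%E) -> (q C <= prob_of P C)%E.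
  move=> cC qC; have mC := closed_borel cC.
  rewrite prob_ofE// -(fineK (fin_num_measure q C mC)); apply: PG => //.
  apply: filterS (sG _ (time_near TT s)) => t [TTt st].
  by rewrite fineK ?fin_num_measure// /mu asboolT//; exact: qC.
split.
- apply/sd_upset; apply: (saturated_closed_le hS) => //.
  + by move=> x y z; exact: le_trans.
  + exact: (closed_order_rel hS hle).
  + move=> C cC sC; apply: near_G => // t TTt st.
    rewrite (T_split TTs TTt st).
    have mC := closed_borel cC; move: C mC sC {cC}.
    apply/sd_upset; apply: hmono => //.
    by have [] := lpu _ (timeB hTT TTs TTt st).
- apply/sd_downset; apply: (saturated_closed_le hS) => //.
  + by move=> x y z xy yz; exact: le_trans yz xy.
  + exact: (closed_rel_flip (closed_order_rel hS hle)).
  + move=> C cC sC; apply: near_G => // t TTt st.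
    rewrite (T_split TTs TTt st).
    have mC := closed_borel cC; move: C mC sC {cC}.
    apply/sd_downset; apply: hmono => //.
    by have [] := lpu _ (timeB hTT TTs TTt st).
Qed.

(** T s phis and phis lie between T t l and T t u for every t >= s, and these
    bounds merge. *)
Lemma contractive_bounded_stable : asymptotically_contractive TT T ->
  order_bounded_trajectory TT T -> globally_stable TT T.
Proof.
move=> hc [p [l [u lpu]]]; have [phis lphisu] := trajectory_limit lpu.
have sphis : stationary TT T phis.
  move=> s TTs; apply: (bhattacharya_eq hS hle).
  apply/ler_addgt0Pr => e e0; rewrite add0r.
  have [t [TTt st te]] := time_cvg0_lt hTT s e0 (hc l u).
  apply: le_trans (ltW te); have [lphis phisu] := lphisu _ TTt.
  have [lphis' phisu'] := lphisu _ (timeB hTT TTs TTt st).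
  by apply: bhattacharya_sandwich => //; rewrite (T_split TTs TTt st);
    exact: hmono.
exists phis; split => //.
- move=> q sq; apply: (bhattacharya_eq hS hle).
  apply/ler_addgt0Pr => e e0; rewrite add0r.
  have [t [TTt _ te]] := time_cvg0_lt hTT 0 e0 (hc q phis).
  by move: te; rewrite sq// sphis// => /ltW.
- move=> q; have PF := time_filter_proper hTT.
  apply: cvg_trans (hc q phis); apply: near_eq_cvg.
  apply: filterS (time_near TT 0) => t [TTt _].
  by rewrite (sphis t TTt).
Qed.

End stability.

Theorem theorem3p1 (R : realType) (d : Order.disp_t)
  (S : POrderedPointedTopological.type d)
  (hS : Polish R S)
  (hle : closed_order S)
  (hcompact : forall A : set S, compact A <-> closed A /\ order_bounded A)
  (TT : set R)
  (hTT : TT = time_continuous R \/ TT = time_discrete R)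
  (T : R -> prob R S -> prob R S)
  (hT : semigroup TT T)
  (hmono : order_preserving TT T) :
  (globally_stable TT T <->
     asymptotically_contractive TT T /\ order_bounded_trajectory TT T) /\
  (globally_stable TT T <->
     asymptotically_contractive TT T /\ tight_trajectory TT T).
Proof.
have stable := contractive_bounded_stable hS hle hcompact hTT hT hmono.
split; split.
- move=> gs; split; first exact: globally_stable_contractive gs.
  exact: globally_stable_bounded gs.
- by move=> [hc]; exact: stable.
- move=> gs; split; first exact: globally_stable_contractive gs.
  have [p [l [u lpu]]] := globally_stable_bounded gs.
  by exists p; exact: order_bounded_trajectory_tight lpu.
- move=> [hc [p tp]]; apply: stable => //.
  have [l [u lpu]] := tight_order_bounded hS hle hcompact tp.
  by exists p, l, u => t TTt; apply: lpu; exists t.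
Qed.
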